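(* Let $(X_n)_{n=1}^\infty$ be a sequence of selfadjoint elements of $\mathfrak{A}$ such that: (1) $\{X_n\}_{n\ge1}$ is a monotonically independent family over $\mathfrak{B}$ with respect to $\Phi$; (2) all $X_n$ have the same moment function, $\mu_{X_i}=\mu_{X_j}$ for all $i,j\ge1$; (3) $\Phi(X_k)=0$ for all $k\ge1$. Then there exists a conditional expectation $\nu:\mathfrak{B}_+\langle\xi\rangle\to\mathfrak{B}$ such that $$\lim_{N\to\infty}\Phi\left(f\left(\frac{X_1+\cdots+X_N}{\sqrt N}\right)\right)=\nu(f)\qquad\text{for every } f\in\mathfrak{B}_+\langle\xi\rangle.$$ Moreover, $\nu$ depends only on the second order moments of the $X_i$, i.e. only on the common map $b\mapsto\Phi(X_ibX_i)$.
   Context: $\mathfrak{A}$ is a $*$-algebra, $\mathfrak{B}$ is a $*$-subalgebra of $\mathfrak{A}$ which is also a C$^*$-algebra, and $\Phi:\mathfrak{A}\to\mathfrak{B}$ is a conditional expectation: linear, $\Phi(b_1xb_2)=b_1\Phi(x)b_2$ for $b_1,b_2\in\mathfrak{B}$, and $\Phi(b)=b$ for $b\in\mathfrak{B}$. $\mathfrak{B}_+\langle\xi\rangle$ is the free noncommutative $*$-algebra generated by $\mathfrak{B}$ and a selfadjoint symbol $\xi$: it is spanned by $\mathfrak{B}$ and the words $b_0\xi b_1\cdots\xi b_n$, $n\ge1$, with each $b_l$ in $\mathfrak{B}$ or absent (i.e. equal to the unit). For $X\in\mathfrak{A}$, $f(X)$ is the image of $f$ under the homomorphism that is the identity on $\mathfrak{B}$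 and sends $\xi$ to $X$. A conditional expectation $\nu:\mathfrak{B}_+\langle\xi\rangle\to\mathfrak{B}$ is a linear map with $\nu(b_1fb_2)=b_1\nu(f)b_2$ for $b_1,b_2\in\mathfrak{B}$ and $f\in\mathfrak{B}_+\langle\xi\rangle$, and $\nu(b)=b$ for $b\in\mathfrak{B}$. The limit is in the norm of $\mathfrak{B}$. For selfadjoint $X\in\mathfrak{A}$, the $n$-th moment of $X$ is the multilinear map $m_{X,n}(b_1,\dots,b_{n-1})=\Phi(Xb_1X\cdots Xb_{n-1}X)$ (arguments $b_l$ in $\mathfrak{B}$ or absent); the moment function $\mu_X$ is the collection of all $m_{X,n}$, $n\ge1$. Monotonic independence. A family $\{\mathfrak{A}_j\}_{j\in I}$ of subalgebras of $\mathfrak{A}$ indexed by a totally ordered set $I$ is monotonically independent over $\mathfrak{B}$ (with respect to $\Phi$) if: (a) for all $i<j>k$ in $I$, all $Y_i\in\mathfrak{A}_i$, $Y_j\in\mathfrak{A}_j$, $Y_k\in\mathfrak{A}_k$ and all $A,B\in\mathfrak{A}$ (either of $A,B$ may also be absent), $\Phi(AY_iY_jY_kB)=\Phi(AY_i\Phi(Y_j)Y_kB)$; (b) for all $i_m>\dots>i_1<k_1<\dots<k_n$ in $I$ and all $Y_l\in\mathfrak{A}_l$: $\Phi(Y_{i_m}\cdots Y_{i_1})=\Phi(Y_{i_m})\cdots\Phi(Y_{i_1})$, $\Phi(Y_{k_1}\cdots Y_{k_n})=\Phi(Y_{k_1})\cdots\Phi(Y_{k_n})$, and $\Phi(Y_{i_m}\cdots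 Y_{i_1}Y_{k_1}\cdots Y_{k_n})=\Phi(Y_{i_m})\cdots\Phi(Y_{i_1})\Phi(Y_{k_1})\cdots\Phi(Y_{k_n})$. Elements $\{X_j\}_{j\in I}$ are monotonically independent over $\mathfrak{B}$ if the subalgebras they generate together with $\mathfrak{B}$ are; here the subalgebra generated by $X_j$ and $\mathfrak{B}$ means the linear span of all words $b_0X_jb_1\cdots X_jb_n$ with $n\ge1$ and each $b_l$ in $\mathfrak{B}$ or absent (elements of $\mathfrak{B}$ alone are not included). The family $(X_n)_{n\ge1}$ is indexed by $\{1<2<\cdots\}$. *)

(* Defs.v *)
From HB Require Import structures.
From mathcomp Require Import all_boot all_order all_algebra.
From mathcomp Require Import all_classical all_reals all_analysis.
From mathcomp Require Import complex.

Set Implicit Arguments.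
Unset Strict Implicit.
Unset Printing Implicit Defensive.

Import Order.TTheory GRing.Theory Num.Theory.
Import numFieldNormedType.Exports.

Local Open Scope classical_set_scope.
Local Open Scope ring_scope.

(* Algebras are not assumed to have a unit (MathComp's rings always do), so    *)
(* the product is the one of MathComp's semigroups; it is written x ** y.      *)
Notation "x ** y" := (x * y)%g (at level 40, left associativity) : ring_scope.

HB.mixin Record Lmodule_isStarAlgebra (K : numClosedFieldType) A
    of GRing.Lmodule K A & Semigroup A := {
  smulDl : forall x y z : A, (x + y) ** z = x ** z + y ** z;
  smulDr : forall x y z : A, x ** (y + z) = x ** y + x ** z;
  smulZl : forall (a : K) (x y : A), (a *: x) ** y = a *: (x ** y);
  smulZr : forall (a : K) (x y : A), x ** (a *: y) = a *: (x ** y);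
  star : A -> A;
  starK : involutive star;
  starD : forall x y : A, star (x + y) = star x + star y;
  starZ : forall (a : K) (x : A), star (a *: x) = a^* *: star x;
  starM : forall x y : A, star (x ** y) = star y ** star x
}.

#[short(type="starAlgType")]
HB.structure Definition StarAlgebra (K : numClosedFieldType) :=
  {A of GRing.Lmodule K A & Semigroup A & Lmodule_isStarAlgebra K A}.

HB.mixin Record StarAlgebra_isCStar (K : numClosedFieldType) B
    of CompleteNormedModule K B & StarAlgebra K B := {
  cstar_normM : forall x y : B, `|x ** y| <= `|x| * `|y|;
  cstar_norm : forall x : B, `|star x ** x| = `|x| ^+ 2
}.

#[short(type="cstarAlgType")]
HB.structure Definition CStarAlgebra (K : numClosedFieldType) :=
  {B of CompleteNormedModule K B & StarAlgebra K B & StarAlgebra_isCStar K B}.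

(* A *-subalgebra is given by its inclusion map. *)
Record star_embedding (K : numClosedFieldType) (B A : starAlgType K)
    (iota : B -> A) : Prop := {
  emb_linear : linear iota;
  emb_mul : {morph iota : x y / x ** y};
  emb_star : {morph iota : x / star x};
  emb_inj : injective iota
}.

Record cond_exp (K : numClosedFieldType) (B A : starAlgType K)
    (iota : B -> A) (Phi : A -> B) : Prop := {
  cond_exp_linear : linear Phi;
  cond_exp_bimod : forall (b1 b2 : B) (x : A),
    Phi (iota b1 ** x ** iota b2) = b1 ** Phi x ** b2;
  cond_exp_id : cancel iota Phi
}.

Section FreeStarAlgebra.
Context {K : numClosedFieldType}.

(* The free *-algebra B_+<xi>: expressions in elements of B and xi, modulo the *)
(* congruence generated by the axioms of (not necessarily unital) K-algebras   *)
(* and by the identification of the operations of B with the formal ones.      *)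
Section Expressions.
Variable B : starAlgType K.

Inductive pexpr : Type :=
  | PB of B
  | PX
  | PD of pexpr & pexpr
  | PZ of K & pexpr
  | PM of pexpr & pexpr.

Inductive pcong : pexpr -> pexpr -> Prop :=
  | pc_refl p : pcong p p
  | pc_sym p q : pcong p q -> pcong q p
  | pc_trans p q r : pcong p q -> pcong q r -> pcong p r
  | pc_D p p' q q' : pcong p p' -> pcong q q' -> pcong (PD p q) (PD p' q')
  | pc_Z a p p' : pcong p p' -> pcong (PZ a p) (PZ a p')
  | pc_M p p' q q' : pcong p p' -> pcong q q' -> pcong (PM p q) (PM p' q')
  | pc_addA p q r : pcong (PD p (PD q r)) (PD (PD p q) r)
  | pc_addC p q : pcong (PD p q) (PD q p)
  | pc_add0 p : pcong (PD (PB 0) p) p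
  | pc_addN p : pcong (PD (PZ (-1) p) p) (PB 0)
  | pc_scaleA a b p : pcong (PZ a (PZ b p)) (PZ (a * b) p)
  | pc_scale1 p : pcong (PZ 1 p) p
  | pc_scaleDr a p q : pcong (PZ a (PD p q)) (PD (PZ a p) (PZ a q))
  | pc_scaleDl a b p : pcong (PZ (a + b) p) (PD (PZ a p) (PZ b p))
  | pc_mulA p q r : pcong (PM p (PM q r)) (PM (PM p q) r)
  | pc_mulDl p q r : pcong (PM (PD p q) r) (PD (PM p r) (PM q r))
  | pc_mulDr p q r : pcong (PM p (PD q r)) (PD (PM p q) (PM p r))
  | pc_mulZl a p q : pcong (PM (PZ a p) q) (PZ a (PM p q))
  | pc_mulZr a p q : pcong (PM p (PZ a q)) (PZ a (PM p q))
  | pc_BD b c : pcong (PB (b + c)) (PD (PB b) (PB c))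
  | pc_BZ a b : pcong (PB (a *: b)) (PZ a (PB b))
  | pc_BM b c : pcong (PB (b ** c)) (PM (PB b) (PB c)).

HB.instance Definition _ := gen_eqMixin pexpr.
HB.instance Definition _ := gen_choiceMixin pexpr.

Definition pcongb (p q : pexpr) : bool := `[< pcong p q >].

Lemma pcongb_refl : reflexive pcongb.
Proof. by move=> p; apply/asboolP; exact: pc_refl. Qed.

Lemma pcongb_sym : symmetric pcongb.
Proof. by move=> p q; apply/asboolP/asboolP; exact: pc_sym. Qed.

Lemma pcongb_trans : transitive pcongb.
Proof.
by move=> q p r /asboolP pq /asboolP qr; apply/asboolP; exact: pc_trans pq qr.
Qed.

Canonical pcong_equiv := EquivRel pcongb pcongb_refl pcongb_sym pcongb_trans.

Definition freeStar : Type := {eq_quot pcong_equiv}%qT.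

HB.instance Definition _ := Choice.on freeStar.

Definition pcls (p : pexpr) : freeStar := (\pi_{eq_quot pcong_equiv} p)%qT.
Definition prep (f : freeStar) : pexpr := repr f.

Lemma prepK f : pcls (prep f) = f.
Proof. exact: reprK. Qed.

Lemma pclsP p q : pcls p = pcls q <-> pcong p q.
Proof.
by split=> [/eqquotP/asboolP//|pq]; apply/eqquotP/asboolP.
Qed.

Lemma prep_pcls p : pcong (prep (pcls p)) p.
Proof. by apply/pclsP; rewrite prepK. Qed.

Lemma freeStar_ind (P : freeStar -> Prop) : (forall p, P (pcls p)) -> forall f, P f.
Proof. by move=> H f; rewrite -(prepK f). Qed.

Fixpoint pstar (p : pexpr) : pexpr :=
  match p with
  | PB b => PB (star b)
  | PX => PX
  | PD p q => PD (pstar p) (pstar q)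
  | PZ a p => PZ a^* (pstar p)
  | PM p q => PM (pstar q) (pstar p)
  end.

Lemma pstarK : involutive pstar.
Proof.
by elim=> //= [b|p -> q ->|a p ->|p -> q ->] //; rewrite (starK, conjCK).
Qed.

Lemma star0 : star (0 : B) = 0.
Proof. by rewrite -(scale0r (0 : B)) starZ rmorph0 !scale0r. Qed.

Lemma pstar_cong p q : pcong p q -> pcong (pstar p) (pstar q).
Proof.
elim=> {p q} /=; try by move=> *; constructor.
- by move=> p q r _ pq _ qr; exact: pc_trans pq qr.
- by move=> p; rewrite star0; exact: pc_add0.
- by move=> p; rewrite star0 rmorphN1; exact: pc_addN.
- by move=> a b p; rewrite rmorphM; exact: pc_scaleA.
- by move=> p; rewrite rmorph1; exact: pc_scale1.
- by move=> a b p; rewrite rmorphD; exact: pc_scaleDl.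
- by move=> p q r; apply/pc_sym/pc_mulA.
- by move=> b c; rewrite starD; exact: pc_BD.
- by move=> a b; rewrite starZ; exact: pc_BZ.
- by move=> b c; rewrite starM; exact: pc_BM.
Qed.

Definition fadd (f g : freeStar) := pcls (PD (prep f) (prep g)).
Definition fscale (a : K) (f : freeStar) := pcls (PZ a (prep f)).
Definition fmul (f g : freeStar) := pcls (PM (prep f) (prep g)).
Definition fstar (f : freeStar) := pcls (pstar (prep f)).

Lemma faddE p q : fadd (pcls p) (pcls q) = pcls (PD p q).
Proof. by apply/pclsP/pc_D; exact: prep_pcls. Qed.

Lemma fscaleE a p : fscale a (pcls p) = pcls (PZ a p).
Proof. by apply/pclsP/pc_Z; exact: prep_pcls. Qed.

Lemma fmulE p q : fmul (pcls p) (pcls q) = pcls (PM p q).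
Proof. by apply/pclsP/pc_M; exact: prep_pcls. Qed.

Lemma fstarE p : fstar (pcls p) = pcls (pstar p).
Proof. by apply/pclsP/pstar_cong/prep_pcls. Qed.

Let ops := (faddE, fscaleE, fmulE, fstarE).

Lemma faddA : associative fadd.
Proof.
elim/freeStar_ind=> p; elim/freeStar_ind=> q; elim/freeStar_ind=> r.
by rewrite !ops; apply/pclsP; exact: pc_addA.
Qed.

Lemma faddC : commutative fadd.
Proof.
elim/freeStar_ind=> p; elim/freeStar_ind=> q.
by rewrite !ops; apply/pclsP; exact: pc_addC.
Qed.

Lemma fadd0 : left_id (pcls (PB 0)) fadd.
Proof. by elim/freeStar_ind=> p; rewrite !ops; apply/pclsP; exact: pc_add0. Qed.

Lemma faddN : left_inverse (pcls (PB 0)) (fscale (-1)) fadd.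
Proof. by elim/freeStar_ind=> p; rewrite !ops; apply/pclsP; exact: pc_addN. Qed.

HB.instance Definition _ :=
  GRing.isZmodule.Build freeStar faddA faddC fadd0 faddN.

Lemma fscaleA a b f : fscale a (fscale b f) = fscale (a * b) f.
Proof.
by elim/freeStar_ind: f => p; rewrite !ops; apply/pclsP; exact: pc_scaleA.
Qed.

Lemma fscale1 : left_id 1 fscale.
Proof. by elim/freeStar_ind=> p; rewrite !ops; apply/pclsP; exact: pc_scale1. Qed.

Lemma fscaleDr : right_distributive fscale fadd.
Proof.
move=> a; elim/freeStar_ind=> p; elim/freeStar_ind=> q.
by rewrite !ops; apply/pclsP; exact: pc_scaleDr.
Qed.

Lemma fscaleDl f : {morph fscale^~ f : a b / a + b >-> fadd a b}.
Proof.
by elim/freeStar_ind: f => p a b; rewrite !ops; apply/pclsP; exact: pc_scaleDl.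
Qed.

HB.instance Definition _ := GRing.Zmodule_isLmodule.Build K freeStar
  fscaleA fscale1 fscaleDr fscaleDl.

HB.instance Definition _ := hasMul.Build freeStar fmul.

Lemma fmulA : associative fmul.
Proof.
elim/freeStar_ind=> p; elim/freeStar_ind=> q; elim/freeStar_ind=> r.
by rewrite !ops; apply/pclsP; exact: pc_mulA.
Qed.

HB.instance Definition _ := Magma_isSemigroup.Build freeStar fmulA.

Lemma fmulDl f g h : fmul (fadd f g) h = fadd (fmul f h) (fmul g h).
Proof.
elim/freeStar_ind: f => p; elim/freeStar_ind: g => q; elim/freeStar_ind: h => r.
by rewrite !ops; apply/pclsP; exact: pc_mulDl.
Qed.

Lemma fmulDr f g h : fmul f (fadd g h) = fadd (fmul f g) (fmul f h).
Proof.
elim/freeStar_ind: f => p; elim/freeStar_ind: g => q; elim/freeStar_ind: h => r.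
by rewrite !ops; apply/pclsP; exact: pc_mulDr.
Qed.

Lemma fmulZl a f g : fmul (fscale a f) g = fscale a (fmul f g).
Proof.
elim/freeStar_ind: f => p; elim/freeStar_ind: g => q.
by rewrite !ops; apply/pclsP; exact: pc_mulZl.
Qed.

Lemma fmulZr a f g : fmul f (fscale a g) = fscale a (fmul f g).
Proof.
elim/freeStar_ind: f => p; elim/freeStar_ind: g => q.
by rewrite !ops; apply/pclsP; exact: pc_mulZr.
Qed.

Lemma fstarK : involutive fstar.
Proof. by elim/freeStar_ind=> p; rewrite !ops pstarK. Qed.

Lemma fstarD f g : fstar (fadd f g) = fadd (fstar f) (fstar g).
Proof.
by elim/freeStar_ind: f => p; elim/freeStar_ind: g => q; rewrite !ops.
Qed.

Lemma fstarZ a f : fstar (fscale a f) = fscale a^* (fstar f).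
Proof. by elim/freeStar_ind: f => p; rewrite !ops. Qed.

Lemma fstarM f g : fstar (fmul f g) = fmul (fstar g) (fstar f).
Proof.
by elim/freeStar_ind: f => p; elim/freeStar_ind: g => q; rewrite !ops.
Qed.

HB.instance Definition _ := Lmodule_isStarAlgebra.Build K freeStar
  fmulDl fmulDr fmulZl fmulZr fstarK fstarD fstarZ fstarM.

Definition fconst (b : B) : freeStar := pcls (PB b).
Definition fxi : freeStar := pcls PX.

Lemma star_fxi : star fxi = fxi.
Proof. exact: fstarE. Qed.

End Expressions.

Section Evaluation.
Variables (B A : starAlgType K) (iota : B -> A) (X : A).

Fixpoint peval (p : pexpr B) : A :=
  match p with
  | PB b => iota b
  | PX => X
  | PD p q => peval p + peval q
  | PZ a p => a *: peval p
  | PM p q => peval p ** peval q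
  end.

(* f(X); by the lemmas below, feval is the unique algebra homomorphism that    *)
(* restricts to iota on B and sends xi to X.                                   *)
Definition feval (f : freeStar B) : A := peval (prep f).

Hypothesis iotaP : star_embedding iota.

Lemma peval_cong p q : pcong p q -> peval p = peval q.
Proof.
have iotaD b c : iota (b + c) = iota b + iota c.
  by have := emb_linear iotaP 1 b c; rewrite !scale1r.
have iota0 : iota 0 = 0.
  by apply: (addIr (iota 0)); rewrite -iotaD !add0r.
have iotaZ a b : iota (a *: b) = a *: iota b.
  by have := emb_linear iotaP a b 0; rewrite iota0 !addr0.
elim=> {p q} /=.
- by [].
- by [].
- by move=> p q r _ -> _ ->.
- by move=> p p' q q' _ -> _ ->.
- by move=> a p p' _ ->.
- by move=> p p' q q' _ -> _ ->.
- by move=> p q r; rewrite addrA.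
- by move=> p q; rewrite addrC.
- by move=> p; rewrite iota0 add0r.
- by move=> p; rewrite iota0 scaleN1r addNr.
- by move=> a b p; rewrite scalerA.
- by move=> p; rewrite scale1r.
- by move=> a p q; rewrite scalerDr.
- by move=> a b p; rewrite scalerDl.
- by move=> p q r; rewrite mulgA.
- by move=> p q r; rewrite smulDl.
- by move=> p q r; rewrite smulDr.
- by move=> a p q; rewrite smulZl.
- by move=> a p q; rewrite smulZr.
- exact: iotaD.
- exact: iotaZ.
- exact: emb_mul.
Qed.

Lemma fevalE p : feval (pcls p) = peval p.
Proof. exact/peval_cong/prep_pcls. Qed.

Lemma feval_const b : feval (fconst b) = iota b.
Proof. exact: fevalE. Qed.

Lemma feval_xi : feval (fxi B) = X.
Proof. exact: fevalE. Qed.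

Lemma feval_linear : linear feval.
Proof.
move=> a; elim/freeStar_ind=> p; elim/freeStar_ind=> q.
have -> : a *: pcls p + pcls q = pcls (PD (PZ a p) q).
  by rewrite -faddE -fscaleE.
by rewrite !fevalE.
Qed.

Lemma feval_mul : {morph feval : f g / f ** g}.
Proof.
elim/freeStar_ind=> p; elim/freeStar_ind=> q.
have -> : pcls p ** pcls q = pcls (PM p q) by rewrite -fmulE.
by rewrite !fevalE.
Qed.

Lemma feval_unique (h : freeStar B -> A) :
  linear h -> {morph h : f g / f ** g} ->
  (forall b, h (fconst b) = iota b) -> h (fxi B) = X -> h =1 feval.
Proof.
move=> hlin hM hB hX; elim/freeStar_ind=> p; rewrite fevalE.
have h0 : h 0 = 0.
  by have := hlin (-1) 0 0; rewrite scaler0 addr0 scaleN1r addNr.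
elim: p => [b||p IHp q IHq|a p IHp|p IHp q IHq] /=.
- exact: hB.
- exact: hX.
- have -> : pcls (PD p q) = 1 *: pcls p + pcls q by rewrite scale1r -faddE.
  by rewrite hlin scale1r IHp IHq.
- have -> : pcls (PZ a p) = a *: pcls p + 0 by rewrite addr0 -fscaleE.
  by rewrite hlin h0 addr0 IHp.
- have -> : pcls (PM p q) = pcls p ** pcls q by rewrite -fmulE.
  by rewrite hM IHp IHq.
Qed.

End Evaluation.

Lemma fconst_embedding (B : starAlgType K) : star_embedding (@fconst B).
Proof.
have idP : star_embedding (@id B) by split=> // x y.
split.
- move=> a b c; rewrite /fconst.
  have -> : a *: pcls (PB b) + pcls (PB c) = pcls (PD (PZ a (PB b)) (PB c)).
    by rewrite -faddE -fscaleE.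
  apply/pclsP; apply: pc_trans (pc_BD _ _) _.
  by apply: pc_D; [exact: pc_BZ | exact: pc_refl].
- move=> b c; have -> : fconst b ** fconst c = pcls (PM (PB b) (PB c)).
    by rewrite -fmulE.
  by apply/pclsP; exact: pc_BM.
- by move=> b; rewrite /fconst /= -[LHS]/(pcls (pstar (PB b))) -fstarE.
- by move=> b c /(congr1 (feval id 0)); rewrite !(feval_const _ idP).
Qed.

End FreeStarAlgebra.

(* None stands for an absent factor. *)
Definition lmulo (A : semigroupType) (a : option A) (x : A) : A :=
  if a is Some a then a ** x else x.
Definition rmulo (A : semigroupType) (x : A) (a : option A) : A :=
  if a is Some a then x ** a else x.

Definition sprod (A : semigroupType) (x : A) (s : seq A) : A :=
  foldl (fun y z => y ** z) x s.

Section Independence.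
Context {K : numClosedFieldType} {B A : starAlgType K}.
Variables (iota : B -> A) (Phi : A -> B).

(* inner_word X [:: b_1; ...; b_(n-1)] = X b_1 X ... X b_(n-1) X *)
Fixpoint inner_word (X : A) (s : seq (option B)) : A :=
  if s is b :: s' then X ** lmulo (omap iota b) (inner_word X s') else X.

(* The moment function of X: on sequences of length n - 1, it is m_(X,n). *)
Definition moment (X : A) (s : seq (option B)) : B := Phi (inner_word X s).

Definition second_moment (X : A) (b : option B) : B := moment X [:: b].

Definition lspan (S : set A) : set A :=
  [set x | exists (n : nat) (c : 'I_n -> K) (w : 'I_n -> A),
     (forall i, S (w i)) /\ x = \sum_(i < n) c i *: w i].

Definition gen_subalg (X : A) : set A :=
  lspan [set y | exists (b0 bn : option B) (s : seq (option B)),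
     y = rmulo (lmulo (omap iota b0) (inner_word X s)) (omap iota bn)].

(* A chain i_m > ... > i_1 is given as the head i = i_m and the tail s; the    *)
(* factors Y (decreasing side) and Z (increasing side) are chosen separately,  *)
(* since an index may occur on both sides of i_m > ... > i_1 < k_1 < ... < k_n *)
Record mono_indep_sets (d : Order.disp_t) (I : orderType d)
    (AA : I -> set A) : Prop := {
  mono_peak : forall (i j k : I), (i < j)%O -> (k < j)%O ->
    forall Yi Yj Yk : A, AA i Yi -> AA j Yj -> AA k Yk ->
    forall a b : option A,
      Phi (rmulo (lmulo a (Yi ** Yj ** Yk)) b) =
      Phi (rmulo (lmulo a (Yi ** iota (Phi Yj) ** Yk)) b);
  mono_decr : forall (i : I) (s : seq I) (Y : I -> A),
    path >%O i s -> {in i :: s, forall l, AA l (Y l)} ->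
    Phi (sprod (Y i) (map Y s)) = sprod (Phi (Y i)) (map (Phi \o Y) s);
  mono_incr : forall (k : I) (t : seq I) (Z : I -> A),
    path <%O k t -> {in k :: t, forall l, AA l (Z l)} ->
    Phi (sprod (Z k) (map Z t)) = sprod (Phi (Z k)) (map (Phi \o Z) t);
  mono_valley : forall (i : I) (s : seq I) (k : I) (t : seq I) (Y Z : I -> A),
    path >%O i s -> (last i s < k)%O -> path <%O k t ->
    {in i :: s, forall l, AA l (Y l)} -> {in k :: t, forall l, AA l (Z l)} ->
    Phi (sprod (Y i) (map Y s ++ map Z (k :: t))) =
    sprod (Phi (Y i)) (map (Phi \o Y) s ++ map (Phi \o Z) (k :: t))
}.

Definition mono_indep (d : Order.disp_t) (I : orderType d) (X : I -> A) : Prop :=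
  mono_indep_sets (fun j => gen_subalg (X j)).

(* The sequence X_1, X_2, ... is indexed from 0. *)
Record clt_sequence (X : nat -> A) : Prop := {
  clt_selfadjoint : forall n, star (X n) = X n;
  clt_indep : mono_indep X;
  clt_moments : forall i j, moment (X i) = moment (X j);
  clt_centered : forall n, Phi (X n) = 0
}.

Definition normalized_sum (X : nat -> A) (N : nat) : A :=
  (sqrtC N%:R)^-1 *: \sum_(i < N) X i.

End Independence.

(* Main.v *)
Require Import Defs.
From HB Require Import structures.
From mathcomp Require Import all_boot all_order all_algebra.
From mathcomp Require Import all_classical all_reals all_analysis.
From mathcomp Require Import complex zify.

Set Implicit Arguments.
Unset Strict Implicit.
Unset Printing Implicit Defensive.

Import Order.TTheory GRing.Theory Num.Theory.
Import numFieldNormedType.Exports.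

Local Open Scope classical_set_scope.
Local Open Scope ring_scope.

(** The expectation of a word in the variables X_i can be computed by reductions.
   Neighbouring factors with the same index merge into one element of the
   algebra generated by that variable. If an index exceeds both neighbouring
   ones, then axiom (a) of monotonic independence replaces the factor by its
   expectation, which is then absorbed by a neighbour. When neither reduction
   applies, the indices first decrease and then increase, and by axiom (b) the
   expectation is the product of the expectations of the factors. The choice of
   reductions depends only on the relative order of the indices, and the values
   that come out are moments of orders at most the number of occurrences of a
   variable. So the expectation of a word is unchanged under increasing changes
   of indices, and under replacing the sequence by another one that has the same
   moments up to these orders ([word_exp_relabel]). Moreover it is 0 when some
   variable occurs only once ([word_exp_singleton]), because the X_i are centered.

   Now let f be a monomial of degree n. Expanding f(X_1 + ... + X_N) gives a sum
   over index sequences of length n. Grouping them by their sets of values, and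
   using that only relative order matters, turns the sum into
   sum_k binomial(N, k) T_k, where T_k is the sum over the sequences that take
   every one of k values ([sum_tuples_binomial], [cond_exp_sum_onto]). If
   2k > n then some value is taken only once and T_k = 0. If 2k <= n, then
   binomial(N, k) / N^(n/2) tends to 1/k! for 2k = n and to 0 for 2k < n
   ([cvg_binomial_sqrtC]). Hence the limit is 0 for odd n, and for n = 2k it is
   T_k / k!, in which only the words where each of the k variables occurs exactly
   twice survive; these are determined by the second order moments
   ([onto_exp_second_moment]).

   Constants and monomials span the free algebra ([freeStar_bw_ind]), so the
   limit exists for every f; linearity and the bimodule property pass to the
   limit because multiplication is continuous in norm. As the algebras have no
   unit, absent coefficients are handled by options throughout; that the
   expectation commutes with multiplication by an element of the subalgebra on
   one side only follows from the C*-identity ([cond_exp_lmul]). *)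

(** * Products in an algebra without unit *)

Section StarAlgebraTheory.
Context {K : numClosedFieldType} {A : starAlgType K}.
Implicit Types (x y z : A) (s t : seq A) (a : option A).

Lemma smul0 x : 0 ** x = 0 :> A.
Proof. by rewrite -[X in X ** _](scale0r 0) smulZl scale0r. Qed.

Lemma smulr0 x : x ** 0 = 0 :> A.
Proof. by rewrite -[X in _ ** X](scale0r 0) smulZr scale0r. Qed.

Lemma smul_suml (I : Type) (r : seq I) (P : pred I) (F : I -> A) x :
  (\sum_(i <- r | P i) F i) ** x = \sum_(i <- r | P i) F i ** x.
Proof.
by apply: (big_morph (fun y => y ** x)) => [y z|]; rewrite ?smulDl ?smul0.
Qed.

Lemma smul_sumr (I : Type) (r : seq I) (P : pred I) (F : I -> A) x :
  x ** (\sum_(i <- r | P i) F i) = \sum_(i <- r | P i) x ** F i.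
Proof.
by apply: (big_morph (fun y => x ** y)) => [y z|]; rewrite ?smulDr ?smulr0.
Qed.

Lemma lmulo_sum a (I : Type) (r : seq I) (F : I -> A) :
  lmulo a (\sum_(i <- r) F i) = \sum_(i <- r) lmulo a (F i).
Proof. by case: a => [b|] //=; rewrite smul_sumr. Qed.

Lemma lmuloZ a (k : K) x : lmulo a (k *: x) = k *: lmulo a x.
Proof. by case: a => [b|] //=; rewrite smulZr. Qed.

Lemma rmuloZ a (k : K) x : rmulo (k *: x) a = k *: rmulo x a.
Proof. by case: a => [b|] //=; rewrite smulZl. Qed.

Lemma lmulo0 a : lmulo a 0 = 0 :> A.
Proof. by case: a => [b|] //=; rewrite smulr0. Qed.

Lemma rmulo0 a : rmulo 0 a = 0 :> A.
Proof. by case: a => [b|] //=; rewrite smul0. Qed.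

Lemma lmulo_mul a x y : lmulo a (x ** y) = lmulo a x ** y.
Proof. by case: a => //= b; rewrite mulgA. Qed.

Lemma rmulo_mul a x y : rmulo (x ** y) a = x ** rmulo y a.
Proof. by case: a => //= b; rewrite mulgA. Qed.

Lemma rmulo_lmulo a a' x : rmulo (lmulo a x) a' = lmulo a (rmulo x a').
Proof. by case: a => //= b; rewrite rmulo_mul. Qed.

Lemma mul_lmulo a x y : x ** lmulo a y = rmulo x a ** y.
Proof. by case: a => //= b; rewrite mulgA. Qed.

(** The empty sequence has no product, so the product of a sequence is an
   optional factor; this is what [lmulo] and [rmulo] take. *)
Definition oprod s : option A := if s is x :: s' then Some (sprod x s') else None.

Lemma sprod_mul x y s : sprod (x ** y) s = x ** sprod y s.
Proof.
by elim: s y => //= z s IHs y; rewrite /sprod /= -mulgA -/(sprod _ _) IHs.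
Qed.

Lemma sprod_cons x s : sprod x s = rmulo x (oprod s).
Proof. by case: s => //= y s; rewrite /sprod /= -/(sprod _ _) sprod_mul. Qed.

Lemma sprod_cat x s t : sprod x (s ++ t) = rmulo (sprod x s) (oprod t).
Proof. by rewrite /sprod foldl_cat -sprod_cons. Qed.

Lemma sprod_zero x s p q : x :: s = p ++ 0 :: q -> sprod x s = 0.
Proof.
case: p => [|y p] [-> ->]; first by rewrite sprod_cons rmulo0.
by rewrite sprod_cat /= [X in _ ** X]sprod_cons rmulo0 smulr0.
Qed.

Lemma oprod_infix (p : seq A) x s q :
  oprod (p ++ x :: s ++ q) =
  Some (rmulo (lmulo (oprod p) (sprod x s)) (oprod q)).
Proof.
case: p => [|y p] /=; first by rewrite sprod_cat.
by rewrite -cat_cons catA !sprod_cat.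
Qed.

End StarAlgebraTheory.

(** * Conditional expectations onto a C*-algebra *)

Section CStarAlgebraTheory.
Context {K : numClosedFieldType} {B : cstarAlgType K}.

Lemma cstar_eq0 (x : B) : star x ** x = 0 -> x = 0.
Proof.
move=> xx0; apply/eqP; rewrite -normr_eq0 -sqrf_eq0.
by have := cstar_norm x; rewrite xx0 normr0 => <-.
Qed.

(** Testing against multipliers on both sides is enough: with both multipliers
   built from z, the product is the square of the selfadjoint element z* z. *)
Lemma cstar_mul2_eq0 (z : B) : (forall c d : B, c ** z ** d = 0) -> z = 0.
Proof.
move=> zP; apply: cstar_eq0; apply: cstar_eq0.
by rewrite starM starK zP.
Qed.

End CStarAlgebraTheory.

Section CondExp.
Context {K : numClosedFieldType} {B A : starAlgType K}.
Variables (iota : B -> A) (Phi : A -> B).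
Hypotheses (iotaP : star_embedding iota) (PhiP : cond_exp iota Phi).

Lemma emb0 : iota 0 = 0.
Proof.
have := emb_linear iotaP 1 0 0; rewrite !scale1r addr0 => e.
by apply: (addrI (iota 0)); rewrite -e addr0.
Qed.

Lemma cond_exp0 : Phi 0 = 0.
Proof.
have := cond_exp_linear PhiP 1 0 0; rewrite !scale1r addr0 => e.
by apply: (addrI (Phi 0)); rewrite -e addr0.
Qed.

Lemma cond_expZ a x : Phi (a *: x) = a *: Phi x.
Proof. by have := cond_exp_linear PhiP a x 0; rewrite cond_exp0 !addr0. Qed.

Lemma cond_exp_sum (I : Type) (r : seq I) (F : I -> A) :
  Phi (\sum_(i <- r) F i) = \sum_(i <- r) Phi (F i).
Proof.
apply: (big_morph Phi _ cond_exp0) => x y.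
by have := cond_exp_linear PhiP 1 x y; rewrite !scale1r.
Qed.

End CondExp.

Section OneSided.
Context {K : numClosedFieldType} {B : cstarAlgType K} {A : starAlgType K}.
Variables (iota : B -> A) (Phi : A -> B).
Hypotheses (iotaP : star_embedding iota) (PhiP : cond_exp iota Phi).

Let PhiB x y : Phi (x - y) = Phi x - Phi y.
Proof.
by rewrite addrC -scaleN1r (cond_exp_linear PhiP) scaleN1r addrC.
Qed.

(** By the bimodule property the two sides agree after multiplication by elements
   of B on the left and on the right, and [cstar_mul2_eq0] then takes the place
   of a unit of B. Absent factors in words make this one-sided form necessary. *)
Lemma cond_exp_lmul b x : Phi (iota b ** x) = b ** Phi x.
Proof.
apply/eqP; rewrite -subr_eq0; apply/eqP/cstar_mul2_eq0 => c d.
rewrite -[X in _ - X]scale1r -scaleNr smulDr smulDl smulZr smulZl scaleN1r.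
rewrite -(cond_exp_bimod PhiP) mulgA -(emb_mul iotaP) (cond_exp_bimod PhiP).
by rewrite mulgA subrr.
Qed.

Lemma cond_exp_rmul b x : Phi (x ** iota b) = Phi x ** b.
Proof.
apply/eqP; rewrite -subr_eq0; apply/eqP/cstar_mul2_eq0 => c d.
rewrite -[X in _ - X]scale1r -scaleNr smulDr smulDl smulZr smulZl scaleN1r.
rewrite -(cond_exp_bimod PhiP) mulgA -[_ ** iota b ** _]mulgA -(emb_mul iotaP).
by rewrite (cond_exp_bimod PhiP) !mulgA subrr.
Qed.

Lemma cond_exp_lmulo b x : Phi (lmulo (omap iota b) x) = lmulo b (Phi x).
Proof. by case: b => //= b; rewrite cond_exp_lmul. Qed.

Lemma cond_exp_rmulo b x : Phi (rmulo x (omap iota b)) = rmulo (Phi x) b.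
Proof. by case: b => //= b; rewrite cond_exp_rmul. Qed.

End OneSided.

(** * Reduction of words *)

Section PeakOrValley.
Variables (T : Type) (f : T -> nat).
Implicit Types (s t p q w : seq T).

(** Adding one term in front of a decreasing-then-increasing sequence creates a
   repetition, creates a peak, or prolongs one of the two monotone parts. *)
Lemma peak_or_valley w : w <> [::] ->
  [\/ exists p a b q, w = p ++ [:: a, b & q] /\ f a = f b,
      exists p a b c q, w = p ++ [:: a, b, c & q] /\ (f a < f b /\ f c < f b)%N
    | exists x s t, [/\ w = x :: s ++ t, path (relpre f gtn) x s
                      & path (relpre f ltn) (last x s) t]].
Proof.
elim: w => // a [|b w] IHw _; first by apply: Or33; exists a, [::], [::].
case: IHw => //.
- by case=> p [c [d [q [-> cd]]]]; apply: Or31; exists (a :: p), c, d, q.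
- case=> p [c [d [e [q [-> cde]]]]].
  by apply: Or32; exists (a :: p), c, d, e, q.
case=> x [s [t [[-> ->] xs st]]]; case: (ltngtP (f a) (f x)) => ax.
- case: s xs st => [|y s] /= xs st.
    by apply: Or33; exists a, [::], (x :: t); rewrite /= ax st.
  case/andP: xs => yx _; apply: Or32.
  by exists [::], a, x, y, (s ++ t).
- by apply: Or33; exists a, (x :: s), t; rewrite /= ax xs st.
- by apply: Or31; exists [::], a, x, (s ++ t).
Qed.

(** Turns factors listed along a chain of indices into a function of the index,
   which is the form in which the axioms of independence take them. *)
Lemma key_section x s : uniq (map f (x :: s)) ->
  exists g : nat -> T,
    map g (map f (x :: s)) = x :: s /\ {in map f (x :: s), cancel g f}.
Proof.
elim: s x => [|y s IHs] x.
  move=> _; exists (fun=> x); split=> // l.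
  by rewrite inE => /eqP ->.
rewrite map_cons cons_uniq => /andP[xNs /IHs[g [gE gK]]].
exists (fun l => if l == f x then x else g l); split.
  rewrite [map _ (_ :: _)]map_cons eqxx -[in RHS]gE; congr (_ :: _).
  by apply/eq_in_map => l ls; case: eqP => // lx; rewrite -lx ls in xNs.
by move=> l; rewrite inE; case: eqP => [->//|_] /= /gK.
Qed.

End PeakOrValley.

Section BWords.
Context {K : numClosedFieldType} {B : starAlgType K}.

(** The monomial b_0 xi b_1 xi ... xi b_n with n positive: [bw_inner] lists
   b_1, ..., b_(n-1), as the arguments of the n-th moment. *)
Record bword := BWord {
  bw_left : option B; bw_inner : seq (option B); bw_right : option B }.

Definition omulo (a b : option B) : option B :=
  if a is Some x then Some (rmulo x b) else b.

Definition bw_mul (c d : bword) : bword :=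
  BWord (bw_left c) (bw_inner c ++ omulo (bw_right c) (bw_left d) :: bw_inner d)
        (bw_right d).

Definition bw_mulr (c : bword) (b : B) : bword :=
  BWord (bw_left c) (bw_inner c) (omulo (bw_right c) (Some b)).

Definition bw_mull (b : B) (c : bword) : bword :=
  BWord (Some (rmulo b (bw_left c))) (bw_inner c) (bw_right c).

(** The expectation of a monomial in an element whose moments are [M]. *)
Definition bw_exp (M : seq (option B) -> B) (c : bword) : B :=
  rmulo (lmulo (bw_left c) (M (bw_inner c))) (bw_right c).

Definition bw_deg (c : bword) : nat := (size (bw_inner c)).+1.

(** A word is a product of monomials, each one in the variable X_i with the
   index i that comes with it. *)
Definition word := seq (nat * bword).

Definition word_deg (i : nat) (w : word) : nat :=
  \sum_(x <- w | x.1 == i) bw_deg x.2.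

Lemma word_deg_cat i w w' : word_deg i (w ++ w') = (word_deg i w + word_deg i w')%N.
Proof. exact: big_cat. Qed.

Lemma word_deg_cons i x w :
  word_deg i (x :: w) = ((x.1 == i) * bw_deg x.2 + word_deg i w)%N.
Proof. by rewrite /word_deg big_cons; case: eqP; rewrite ?mul1n. Qed.

Lemma bw_deg_mul c d : bw_deg (bw_mul c d) = (bw_deg c + bw_deg d)%N.
Proof. by rewrite /bw_deg size_cat /= addSn addnS. Qed.

Lemma word_deg1 i w : word_deg i w = 1%N ->
  exists p y q, w = p ++ y :: q /\ bw_deg y.2 = 1%N.
Proof.
elim: w => [|x w IHw]; first by rewrite /word_deg big_nil.
rewrite word_deg_cons; case: eqP => _ /=; rewrite ?mul0n ?mul1n ?add0n.
  by rewrite /bw_deg addSn => -[/eqP]; rewrite addn_eq0 => /andP[/eqP x0 _];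
     exists [::], x, w; rewrite /bw_deg x0.
by case/IHw => p [y [q [-> y1]]]; exists (x :: p), y, q.
Qed.

(** The two reductions of a word shorten it: neighbours with the same index are
   merged, and a monomial whose index exceeds both neighbouring ones is replaced
   by its expectation. The words that allow neither of them have indices that
   first decrease and then increase. *)
Lemma word_ind (e : bword -> B) (P : word -> Prop) :
  P [::] ->
  (forall x s t, path (relpre fst gtn) x s ->
     path (relpre fst ltn) (last x s) t -> P (x :: s ++ t)) ->
  (forall p i c d q,
     P (p ++ (i, bw_mul c d) :: q) -> P (p ++ [:: (i, c), (i, d) & q])) ->
  (forall p i c j d k e' q, (i < j)%N -> (k < j)%N ->
     P (p ++ [:: (i, bw_mulr c (e d)), (k, e') & q]) ->
     P (p ++ [:: (i, c), (j, d), (k, e') & q])) ->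
  forall w, P w.
Proof.
move=> P0 Pvalley Pmerge Ppeak w.
have [n] := ubnP (size w); elim: n w => // n IHn [//|x w] wn.
case: (@peak_or_valley _ fst (x :: w)) => //.
- case=> p [[i c] [[j d] [q [wE /= ij]]]]; move: wn; rewrite wE -{}ij => wn.
  apply/Pmerge/IHn; move: wn; rewrite !size_cat /= !addnS.
  by rewrite ltnS; apply: leq_trans.
- case=> p [[i c] [[j d] [[k e'] [q [wE /= [ij kj]]]]]]; move: wn; rewrite wE.
  move=> wn; apply/Ppeak/IHn => //; move: wn; rewrite !size_cat /= !addnS.
  by rewrite ltnS; apply: leq_trans.
- by case=> y [s [t [-> ys st]]]; exact: Pvalley.
Qed.

Section Evaluation.
Context {A : starAlgType K}.
Variables (iota : B -> A) (iotaP : star_embedding iota).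

Definition bw_eval (X : A) (c : bword) : A :=
  rmulo (lmulo (omap iota (bw_left c)) (inner_word iota X (bw_inner c)))
        (omap iota (bw_right c)).

Lemma inner_word_cat (X : A) s b s' :
  inner_word iota X (s ++ b :: s') =
  inner_word iota X s ** lmulo (omap iota b) (inner_word iota X s').
Proof. by elim: s => //= c s ->; rewrite lmulo_mul mulgA. Qed.

Lemma lmulo_omulo a b (x : A) : lmulo (omap iota (omulo a b)) x =
  lmulo (omap iota a) (lmulo (omap iota b) x).
Proof. by case: a b => [a|] [b|] //=; rewrite (emb_mul iotaP) mulgA. Qed.

Lemma rmulo_omulo a b (x : A) : rmulo x (omap iota (omulo a b)) =
  rmulo (rmulo x (omap iota a)) (omap iota b).
Proof. by case: a b => [a|] [b|] //=; rewrite (emb_mul iotaP) mulgA. Qed.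

Lemma bw_eval_mul (X : A) c d :
  bw_eval X (bw_mul c d) = bw_eval X c ** bw_eval X d.
Proof.
rewrite /bw_eval /= inner_word_cat lmulo_omulo lmulo_mul rmulo_mul.
by rewrite [X in _ ** X]rmulo_lmulo mul_lmulo.
Qed.

Lemma bw_eval_mulr (X : A) c b : bw_eval X (bw_mulr c b) = bw_eval X c ** iota b.
Proof. by rewrite /bw_eval /= rmulo_omulo. Qed.

Lemma bw_eval_mull (X : A) c b : bw_eval X (bw_mull b c) = iota b ** bw_eval X c.
Proof.
rewrite /bw_eval /= -rmulo_mul; congr rmulo.
by case: (bw_left c) => [a|] //=; rewrite (emb_mul iotaP) mulgA.
Qed.

Lemma bw_eval_gen (X : A) c : gen_subalg iota X (bw_eval X c).
Proof.
exists 1%N, (fun=> 1), (fun=> bw_eval X c); split=> [_|].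
  by exists (bw_left c), (bw_right c), (bw_inner c).
by rewrite big_ord1 scale1r.
Qed.

End Evaluation.
End BWords.
Arguments bword {K} B.
Arguments word {K} B.

(** * Words in monotonically independent variables *)

Section CltSequence.
Context {K : numClosedFieldType} {B : cstarAlgType K} {A : starAlgType K}.
Variables (iota : B -> A) (Phi : A -> B) (X : nat -> A).
Hypotheses (iotaP : star_embedding iota) (PhiP : cond_exp iota Phi).
Hypothesis XP : clt_sequence iota Phi X.

Let M := moment iota Phi (X 0).

Let ev (x : nat * bword B) : A := bw_eval iota (X x.1) x.2.

Definition word_exp (w : word B) : B := oapp Phi 0 (oprod (map ev w)).

Lemma cond_exp_bw_eval i c : Phi (bw_eval iota (X i) c) = bw_exp M c.
Proof.
rewrite /bw_exp /bw_eval (cond_exp_rmulo iotaP PhiP) (cond_exp_lmulo iotaP PhiP).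
by rewrite -/(moment _ _ _ _) (clt_moments XP i 0).
Qed.

Lemma word_exp_merge p i c d q :
  word_exp (p ++ [:: (i, c), (i, d) & q]) = word_exp (p ++ (i, bw_mul c d) :: q).
Proof.
rewrite /word_exp !map_cat.
rewrite (oprod_infix _ (ev (i, c)) [:: ev (i, d)] (map ev q)).
rewrite (oprod_infix _ (ev (i, bw_mul c d)) [::] (map ev q)).
by rewrite /ev /sprod /= (bw_eval_mul iotaP).
Qed.

Lemma word_exp_peak p i c j d k e q : (i < j)%N -> (k < j)%N ->
  word_exp (p ++ [:: (i, c), (j, d), (k, e) & q]) =
  word_exp (p ++ [:: (i, bw_mulr c (bw_exp M d)), (k, e) & q]).
Proof.
move=> ij kj; rewrite /word_exp !map_cat.
rewrite (oprod_infix _ (ev (i, c)) [:: ev (j, d); ev (k, e)] (map ev q)).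
rewrite (oprod_infix _ (ev (i, bw_mulr c (bw_exp M d))) [:: ev (k, e)] (map ev q)).
rewrite /ev /sprod /= (bw_eval_mulr iotaP) -(cond_exp_bw_eval j d).
by apply: (mono_peak (clt_indep XP)) (ij) (kj) _ _ _ _ _ _ _ _; exact: bw_eval_gen.
Qed.

Lemma word_exp_valley x s t : path (relpre fst gtn) x s ->
  path (relpre fst ltn) (last x s) t ->
  word_exp (x :: s ++ t) =
  sprod (bw_exp M x.2) (map (fun y => bw_exp M y.2) (s ++ t)).
Proof.
move=> xs st.
have evE y : Phi (ev y) = bw_exp M y.2 by exact: cond_exp_bw_eval.
have gtn_path r y : path (relpre fst gtn) y r = path >%O y.1 (map fst r).
  by rewrite path_map.
have ltn_path r y : path (relpre fst ltn) y r = path <%O y.1 (map fst r).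
  by rewrite path_map.
(* The independence axioms take the factors as functions of the index, which is
   possible because the indices on each side of the valley are distinct. *)
have [g [gE gK]] : exists g : nat -> nat * bword B,
    map g (map fst (x :: s)) = x :: s /\ {in map fst (x :: s), cancel g fst}.
  apply: key_section; apply: (sorted_uniq (leT := gtn)).
  - by move=> a b c ab bc; exact: ltn_trans bc ab.
  - by move=> a; exact: ltnn.
  - by rewrite /= path_map.
have gAA : {in x.1 :: map fst s, forall l, gen_subalg iota (X l) (ev (g l))}.
  by move=> l ls; rewrite /ev (gK l ls); exact: bw_eval_gen.
have [gx gs] : g x.1 = x /\ map g (map fst s) = s.
  by case: gE => gx gs; split.
have mapg (U : Type) (h : nat * bword B -> U) :
    map (h \o g) (map fst s) = map h s by rewrite map_comp gs.
case: t st => [|y t] st.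
  have := mono_decr (clt_indep XP) (i := x.1) (s := map fst s) (Y := ev \o g).
  rewrite /word_exp cats0 -gtn_path => /(_ xs gAA) /=.
  rewrite mapg gx evE => ->; congr sprod.
  by rewrite -[in RHS]mapg; apply/eq_map => l /=.
case/andP: st => sy yt.
have [h [hE hK]] : exists h : nat -> nat * bword B,
    map h (map fst (y :: t)) = y :: t /\ {in map fst (y :: t), cancel h fst}.
  apply: key_section; apply: (sorted_uniq ltn_trans ltnn).
  by rewrite /= path_map.
have hAA : {in y.1 :: map fst t, forall l, gen_subalg iota (X l) (ev (h l))}.
  by move=> l lt; rewrite /ev (hK l lt); exact: bw_eval_gen.
have := mono_valley (clt_indep XP) (i := x.1) (s := map fst s)
  (k := y.1) (t := map fst t) (Y := ev \o g) (Z := ev \o h).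
rewrite -gtn_path -ltn_path last_map => /(_ xs sy yt gAA hAA).
have maph (U : Type) (f : nat * bword B -> U) :
    map (f \o h) (y.1 :: map fst t) = map f (y :: t).
  by rewrite map_comp -[y.1 :: _]/(map fst (y :: t)) hE.
rewrite mapg maph -map_cat /= !gx evE /word_exp /= => ->; congr sprod.
rewrite map_cat; congr cat.
  by rewrite -[in RHS]mapg; apply/eq_map => l /=.
rewrite -[RHS](maph _ (fun z => bw_exp M z.2)) -(eq_map (fun l => evE (h l))).
by [].
Qed.

(** A variable that occurs once in a word is centered, and no reduction merges it
   with another one: it either becomes a peak, and is replaced by 0, or ends as a
   factor 0 of the final product. *)
Lemma word_exp_singleton i w : word_deg i w = 1%N -> word_exp w = 0.
Proof.
have bw_exp0 c : bw_deg c = 1%N -> bw_exp M c = 0.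
  case: c => a [|? ?] b // _; rewrite /bw_exp /=.
  by rewrite [M [::]](clt_centered XP) lmulo0 rmulo0.
have deg_gt0 (c : bword B) : (0 < bw_deg c)%N by [].
elim/(word_ind (e := bw_exp M)): w.
- by rewrite /word_deg big_nil.
- move=> x s t xs st /word_deg1[p [y [q [wE /bw_exp0 y0]]]].
  rewrite word_exp_valley //; apply: (@sprod_zero _ _ _ _
    (map (fun z => bw_exp M z.2) p) (map (fun z => bw_exp M z.2) q)).
  rewrite -(map_cons (fun z => bw_exp M z.2)) wE map_cat map_cons y0.
  reflexivity.
- move=> p j c d q IH; rewrite word_exp_merge => w1; apply: IH; rewrite -w1.
  by rewrite !word_deg_cat !word_deg_cons /= bw_deg_mul mulnDr !addnA.
- move=> p k c j d l e q kj lj IH; rewrite word_exp_peak //.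
  rewrite !word_deg_cat !word_deg_cons /=; have [ji|ji] := eqVneq j i; last first.
    by rewrite mul0n add0n => w1; apply: IH; rewrite word_deg_cat !word_deg_cons.
  rewrite mul1n => w1; have d1 : bw_deg d = 1%N.
    by move: w1; rewrite /bw_deg; lia.
  rewrite /word_exp map_cat bw_exp0 //=.
  rewrite (oprod_infix _ (ev (k, bw_mulr c 0)) [::] (ev (l, e) :: map ev q)) /=.
  rewrite /ev /= (bw_eval_mulr iotaP) (emb0 iotaP) smulr0.
  by rewrite /sprod /= lmulo0 smul0 (cond_exp0 PhiP).
Qed.

End CltSequence.

Section Relabel.
Context {K : numClosedFieldType} {B : cstarAlgType K} {A A' : starAlgType K}.
Variables (iota : B -> A) (Phi : A -> B) (X : nat -> A).
Hypotheses (iotaP : star_embedding iota) (PhiP : cond_exp iota Phi).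
Hypothesis XP : clt_sequence iota Phi X.
Variables (iota' : B -> A') (Phi' : A' -> B) (X' : nat -> A').
Hypotheses (iotaP' : star_embedding iota') (PhiP' : cond_exp iota' Phi').
Hypothesis XP' : clt_sequence iota' Phi' X'.

(** The reductions of a word and of the word with order-preserving changes of
   indices are the same, and they only evaluate moments of an order which is at
   most the degree of the word in some variable. *)
Lemma word_exp_relabel (g : nat -> nat) (w : word B) :
  (forall s i, (size s < word_deg i w)%N ->
     moment iota Phi (X 0) s = moment iota' Phi' (X' 0) s) ->
  {in map fst w &, {homo g : i j / (i < j)%N}} ->
  word_exp iota Phi X w =
  word_exp iota' Phi' X' (map (fun x => (g x.1, x.2)) w).
Proof.
pose r (x : nat * bword B) := (g x.1, x.2).
set M := moment iota Phi (X 0); set M' := moment iota' Phi' (X' 0).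
have expE y (v : word B) : (forall s i, (size s < word_deg i v)%N -> M s = M' s) ->
    (bw_deg y.2 <= word_deg y.1 v)%N -> bw_exp M y.2 = bw_exp M' y.2.
  by move=> MM' yv; rewrite /bw_exp (MM' _ y.1).
elim/(word_ind (e := bw_exp M)): w => //.
- move=> x s t xs st MM' gP; rewrite (word_exp_valley iotaP PhiP XP) //.
  have gpath (e : rel nat) y v :
      {subset map fst (y :: v) <= map fst (x :: s ++ t)} ->
      {in map fst (x :: s ++ t) &, {homo g : i j / e i j}} ->
      path (relpre fst e) y v -> path (relpre fst e) (r y) (map r v).
    move=> /allP sub ge; rewrite -[path _ y v]path_map.
    rewrite -[path _ (r y) _]path_map -map_comp.
    have -> : map (fst \o r) v = map g (map fst v) by rewrite -map_comp.
    exact: (homo_path_in ge).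
  rewrite -[X in word_exp _ _ _ X]/(r x :: map r (s ++ t)) [map r _]map_cat.
  rewrite (word_exp_valley iotaP' PhiP' XP').
  + have e y p q : x :: s ++ t = p ++ y :: q -> bw_exp M y.2 = bw_exp M' y.2.
      move=> wE; apply: (expE _ _ MM'); rewrite wE word_deg_cat word_deg_cons.
      by rewrite eqxx mul1n addnCA leq_addr.
    rewrite (e x [::] (s ++ t)) //; congr sprod; rewrite -map_cat -map_comp.
    have es p q : x :: s ++ t = p ++ q ->
        map (fun y => bw_exp M y.2) q = map (fun y => bw_exp M' y.2) q.
      elim: q p => //= y q IHq p wE.
      by rewrite (e y p q) // (IHq (rcons p y)) // -cats1 -catA.
    exact: (es [:: x]).
  + apply: gpath xs; first by move=> i; rewrite /= !inE map_cat mem_cat orbA => ->.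
    by move=> i j iw jw; exact: gP.
  + rewrite last_map; apply: gpath st => // i.
    rewrite /= !inE map_cat mem_cat -(last_map fst) => /orP[/eqP ->|->].
      by rewrite orbA; have := mem_last x.1 (map fst s); rewrite inE => ->.
    by rewrite !orbT.
- move=> p i c d q IH MM' gP; rewrite (word_exp_merge Phi X iotaP) IH.
  + by rewrite !map_cat /= (word_exp_merge Phi' X' iotaP').
  + move=> s j sj; apply: (MM' s j); apply: leq_trans sj _.
    by rewrite !word_deg_cat !word_deg_cons /= bw_deg_mul mulnDr !addnA.
  + move=> j k jw kw; apply: gP.
      by move: jw; rewrite !map_cat !mem_cat /= !inE; case/or3P=> ->; rewrite ?orbT.
    by move: kw; rewrite !map_cat !mem_cat /= !inE; case/or3P=> ->; rewrite ?orbT.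
- move=> p i c j d k e q ij kj IH MM' gP.
  rewrite (word_exp_peak iotaP PhiP XP) // IH.
  + rewrite !map_cat /= (word_exp_peak iotaP' PhiP' XP').
    * rewrite (expE (j, d) _ MM') // word_deg_cat !word_deg_cons /= eqxx.
      by rewrite mul1n; lia.
    * by apply: gP; rewrite // map_cat mem_cat /= !inE eqxx ?orbT.
    * by apply: gP; rewrite // map_cat mem_cat /= !inE eqxx ?orbT.
  + move=> s l sl; apply: (MM' s l); apply: leq_trans sl _.
    by rewrite !word_deg_cat !word_deg_cons /= /bw_deg /=; lia.
  + move=> l m lw mw; apply: gP.
      by move: lw; rewrite !map_cat !mem_cat /= !inE; case/or4P=> ->; rewrite ?orbT.
    by move: mw; rewrite !map_cat !mem_cat /= !inE; case/or4P=> ->; rewrite ?orbT.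
Qed.

End Relabel.

(** * Expansion of the moments of a sum *)

Section BigTuple.
Variables (R : nmodType) (T : finType).

Lemma big_tuple0 (F : seq T -> R) : \sum_(t : 0.-tuple T) F t = F [::].
Proof. by rewrite (big_pred1 [tuple]) // => t; apply/esym/eqP; exact: tuple0. Qed.

Lemma big_tupleS n (F : seq T -> R) :
  \sum_(t : n.+1.-tuple T) F t = \sum_x \sum_(t : n.-tuple T) F (x :: t).
Proof.
rewrite pair_big /= (reindex (fun p => cons_tuple p.1 p.2)) //=.
exists (fun t => (thead t, behead_tuple t)) => [[x t] _|t _] /=.
  by rewrite theadE; congr pair; apply/val_inj.
by rewrite [in RHS](tuple_eta t).
Qed.

End BigTuple.

Section Expansion.
Context {K : numClosedFieldType} {B : cstarAlgType K} {A : starAlgType K}.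
Variables (iota : B -> A) (Phi : A -> B) (X : nat -> A).
Hypotheses (PhiP : cond_exp iota Phi).

Fixpoint letters (a : option B) (s : seq (option B)) (b : option B) :
    seq (bword B) :=
  if s is c :: s' then BWord a [::] c :: letters None s' b
  else [:: BWord a [::] b].

Definition bw_word (c : bword B) (t : seq nat) : word B :=
  zip t (letters (bw_left c) (bw_inner c) (bw_right c)).

Lemma word_deg_bw_word c i t :
  size t = bw_deg c -> word_deg i (bw_word c t) = count_mem i t.
Proof.
case: c => a s b; rewrite /bw_deg /bw_word /=.
elim: s a t => [|d s IHs] a [|j t] //= [].
  move=> /size0nil ->.
  by rewrite word_deg_cons /word_deg big_nil /bw_deg /= muln1.
by move=> tn; rewrite word_deg_cons IHs //= /bw_deg /= muln1.
Qed.

Lemma bw_eval_sum N c : bw_eval iota (\sum_(i < N) X i) c =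
  \sum_(t : (bw_deg c).-tuple 'I_N)
    odflt 0 (oprod [seq bw_eval iota (X x.1) x.2 | x <- bw_word c (map val t)]).
Proof.
case: c => a s b; rewrite /bw_deg /bw_word /bw_eval /=.
pose S := \sum_(i < N) X i.
pose F a s (t : seq 'I_N) := oprod [seq bw_eval iota (X x.1) x.2 |
  x <- zip (map val t) (letters a s b)].
have FS a' d s' (x : 'I_N) (t : (size s').+1.-tuple 'I_N) :
    odflt 0 (F a' (d :: s') (x :: t)) =
    lmulo (omap iota a') (X x) ** lmulo (omap iota d) (odflt 0 (F None s' t)).
  rewrite /F /= sprod_cons mul_lmulo /bw_eval /=.
  by case: t => -[|y t] //= _; case: s' => [|c s'].
rewrite -/S; have sumE : forall s a, rmulo (lmulo (omap iota a)
    (inner_word iota S s)) (omap iota b) =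
    \sum_(t : (size s).+1.-tuple 'I_N) odflt 0 (F a s t).
  elim=> [|d s' IHs] a'.
    rewrite (big_tupleS _ (fun t => odflt 0 (F a' [::] t))) rmulo_lmulo /S.
    rewrite [rmulo _ _](_ : _ = \sum_(i < N) rmulo (X i) (omap iota b)); last first.
      by case: (b) => [c|] //=; rewrite smul_suml.
    rewrite lmulo_sum; apply: eq_bigr => i _.
    rewrite (big_tuple0 (fun t => odflt 0 (F a' [::] (i :: t)))).
    by rewrite /F /= /bw_eval /= rmulo_lmulo.
  rewrite /= (big_tupleS _ (fun t => odflt 0 (F a' (d :: s') t))).
  rewrite lmulo_mul rmulo_mul rmulo_lmulo.
  rewrite -[rmulo _ _]/(rmulo (lmulo (omap iota None) _) _) IHs.
  rewrite lmulo_sum smul_suml; apply: eq_bigr => i _.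
  by rewrite lmulo_sum smul_sumr; apply: eq_bigr => t _; rewrite FS.
exact: sumE.
Qed.

Lemma cond_exp_bw_eval_sum N c : Phi (bw_eval iota (\sum_(i < N) X i) c) =
  \sum_(t : (bw_deg c).-tuple 'I_N) word_exp iota Phi X (bw_word c (map val t)).
Proof.
rewrite bw_eval_sum (cond_exp_sum PhiP); apply: eq_bigr => t _.
by rewrite /word_exp; case: (oprod _) => //=; rewrite (cond_exp0 PhiP).
Qed.

Lemma bw_eval_scale (k : K) (x : A) c :
  bw_eval iota (k *: x) c = k ^+ bw_deg c *: bw_eval iota x c.
Proof.
case: c => a s b; rewrite /bw_deg /bw_eval /=.
have -> : inner_word iota (k *: x) s = k ^+ (size s).+1 *: inner_word iota x s.
  elim: s => [|d s IHs] /=; first by rewrite expr1.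
  by rewrite IHs lmuloZ smulZl smulZr scalerA -exprS.
by rewrite lmuloZ rmuloZ.
Qed.

End Expansion.

(** * Grouping index sequences by their sets of values *)

Section Grouping.
Variables (V : nmodType) (m : nat) (F : seq nat -> V).

Let n := m.+1.

Hypothesis F_homo : forall (g : nat -> nat) (t : seq nat), size t = n ->
  {in t &, {homo g : i j / (i < j)%N}} -> F (map g t) = F t.

Definition onto_sum (k : nat) : V :=
  \sum_(t : n.-tuple 'I_k | [set x in t] == [set: 'I_k]%SET) F (map val t).

Lemma sum_tuples_image N (S : {set 'I_N}) :
  \sum_(t : n.-tuple 'I_N | [set x in t] == S) F (map val t) = onto_sum #|S|.
Proof.
have [->|[x0 x0S]] := set_0Vmem S.
  rewrite /onto_sum cards0 [LHS]big1 ?[RHS]big1 //.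
    by move=> t _; case: (thead t).
  move=> t /eqP/setP/(_ (thead t)); rewrite !inE.
  by rewrite (tuple_eta t) /= inE eqxx.
pose g i := nth 0%N (map val (enum S)) i.
have gE (i : 'I_#|S|) : g i = enum_val i.
  by rewrite /g (nth_map x0) ?(enum_val_nth x0) // -cardE.
have enumS : sorted ltn (map val (enum S)).
  rewrite sorted_map /enum_mem; apply: sorted_filter.
    by move=> x y z; exact: ltn_trans.
  by rewrite -enumT -sorted_map val_enum_ord iota_ltn_sorted.
rewrite (reindex_onto (map_tuple enum_val) (map_tuple (enum_rank_in x0S))) /=.
  apply: eq_big => [t|t _]; last first.
    rewrite -[RHS](F_homo (g := g)) ?size_map ?size_tuple //.
      by rewrite -!map_comp; congr F; apply/eq_map => i; exact/esym/gE.
    move=> _ _ /mapP[i _ ->] /mapP[j _ ->] ij.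
    apply: (sorted_ltn_nth ltn_trans 0%N enumS) => //;
      rewrite inE size_map -cardE; exact: ltn_ord.
  have -> : map_tuple (enum_rank_in x0S) (map_tuple enum_val t) == t.
    apply/eqP/val_inj; rewrite /= -map_comp map_id_in // => i _ /=.
    exact: enum_valK_in.
  rewrite andbT; apply/eqP/eqP => [/setP tS|/setP tT].
    apply/setP => i; rewrite !inE.
    have := tS (enum_val i); rewrite enum_valP inE mem_map //; exact: enum_val_inj.
  apply/setP => x; rewrite inE; apply/mapP/idP => [[i _ ->]|xS].
    exact: enum_valP.
  exists (enum_rank_in x0S x); last by rewrite enum_rankK_in.
  by have := tT (enum_rank_in x0S x); rewrite !inE.
move=> t /eqP tS; apply/val_inj; rewrite /= -map_comp map_id_in // => x xt /=.
by rewrite enum_rankK_in // -tS inE.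
Qed.

(** The index sequences with values in a given k-element set correspond, by the
   increasing enumeration of the set, to those that take all values below k. *)
Lemma sum_tuples_binomial N :
  \sum_(t : n.-tuple 'I_N) F (map val t) =
  \sum_(k < n.+1) onto_sum k *+ 'C(N, k).
Proof.
rewrite (partition_big (fun t : n.-tuple 'I_N => [set x in t])
  (fun S : {set 'I_N} => #|S| <= n)%N) /=; last first.
  move=> t _; rewrite -[X in (_ <= X)%N](size_tuple t) cardsE; exact: card_size.
under eq_bigr do rewrite sum_tuples_image.
rewrite (partition_big (fun S : {set 'I_N} => inord #|S| : 'I_n.+1) xpredT) //=.
apply: eq_bigr => k _.
rewrite (eq_big (fun S : {set 'I_N} => S \in [set S : {set 'I_N} | #|S| == k]%SET)
  (fun=> onto_sum k)).
- by rewrite sumr_const card_draws card_ord.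
- move=> S; rewrite inE; apply/andP/eqP => [[Sn /eqP <-]|Sk].
    by rewrite inordK.
  by rewrite Sk inord_val eqxx -ltnS.
- by move=> S /andP[Sn /eqP <-]; rewrite inordK.
Qed.

End Grouping.

(** * Which index sequences contribute to the limit *)

Section OntoCount.

(** An onto sequence takes every value, so if no value is taken once then there
   are at least twice as many terms as values. *)
Lemma onto_count (n k : nat) (t : n.-tuple 'I_k) :
  [set x in t] == [set: 'I_k]%SET -> (n <= k.*2)%N ->
  (exists i : nat, count_mem i (map val t) = 1%N) \/
  (n = k.*2 /\ forall i : nat, (count_mem i (map val t) <= 2)%N).
Proof.
move=> /eqP tT nk.
have cE (i : 'I_k) : count_mem (val i) (map val t) = count_mem i t.
  by rewrite count_map; apply: eq_count => j /=; rewrite val_eqE.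
have [/existsP[i /eqP i1]|/existsPn n1] :=
    boolP [exists i : 'I_k, count_mem i t == 1%N].
  by left; exists (val i); rewrite cE.
have ge2 (i : 'I_k) : (2 <= count_mem i t)%N.
  have /setP/(_ i) := tT; rewrite !inE -has_pred1 has_count.
  by have := n1 i; case: count => [|[|]].
have nE : n = (\sum_(i < k) count_mem i t)%N.
  rewrite -{1}(size_tuple t) -sum1_size (partition_big id xpredT) //=.
  by apply: eq_bigr => i _; rewrite -sum1_count.
have k2 : (\sum_(i < k) 2)%N = k.*2 by rewrite sum_nat_const card_ord muln2.
have nk2 : n = k.*2.
  by apply/eqP; rewrite eqn_leq nk nE -k2 leq_sum.
right; split=> // i; have [ik|ki] := ltnP i k; last first.
  rewrite (count_memPn _) //; apply/mapP => -[j _ ij].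
  by move: ki; rewrite ij leqNgt ltn_ord.
rewrite (_ : i = val (Ordinal ik)) // cE; move: (Ordinal ik) => {ik} j {i}.
have /eqP : (\sum_(i < k) (count_mem i t - 2))%N = 0%N.
  rewrite sumnB; last by move=> i _; exact: ge2.
  by rewrite -nE k2 nk2 subnn.
by rewrite sum_nat_eq0 => /forallP/(_ j); rewrite subn_eq0.
Qed.

End OntoCount.

Section OntoSums.
Context {K : numClosedFieldType} {B : cstarAlgType K} {A : starAlgType K}.
Variables (iota : B -> A) (Phi : A -> B) (X : nat -> A).
Hypotheses (iotaP : star_embedding iota) (PhiP : cond_exp iota Phi).
Hypothesis XP : clt_sequence iota Phi X.
Implicit Types (c : bword B) (t : seq nat).

Definition onto_exp c k : B :=
  onto_sum (size (bw_inner c)) (fun t => word_exp iota Phi X (bw_word c t)) k.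

Lemma map_fst_bw_word c t : size t = bw_deg c -> map fst (bw_word c t) = t.
Proof.
move=> tc; apply: unzip1_zip; rewrite tc /bw_deg; case: c {tc} => a s b /=.
by elim: s a => //= d s IHs a; rewrite ltnS; exact: IHs.
Qed.

Lemma map_bw_word (g : nat -> nat) c t :
  map (fun x => (g x.1, x.2)) (bw_word c t) = bw_word c (map g t).
Proof.
rewrite /bw_word; elim: t (letters _ _ _) => [|i t IHt] [|d l] //=.
by rewrite IHt.
Qed.

Lemma word_exp_homo c (g : nat -> nat) t : size t = bw_deg c ->
  {in t &, {homo g : i j / (i < j)%N}} ->
  word_exp iota Phi X (bw_word c (map g t)) = word_exp iota Phi X (bw_word c t).
Proof.
move=> tc gP; rewrite -map_bw_word.
apply/esym/(word_exp_relabel iotaP PhiP XP iotaP PhiP XP) => //.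
by rewrite map_fst_bw_word.
Qed.

Lemma cond_exp_sum_onto N c : Phi (bw_eval iota (\sum_(i < N) X i) c) =
  \sum_(k < (bw_deg c).+1) onto_exp c k *+ 'C(N, k).
Proof.
rewrite (cond_exp_bw_eval_sum X PhiP).
apply: (sum_tuples_binomial (F := fun t => word_exp iota Phi X (bw_word c t))).
by move=> g t tc gP; exact: word_exp_homo.
Qed.

Lemma onto_exp_eq0 c k : (bw_deg c < k.*2)%N -> onto_exp c k = 0.
Proof.
move=> ck; apply: big1 => t tT.
case: (onto_count tT (ltnW ck)) => [[i i1]|[ck' _]].
  apply: (word_exp_singleton iotaP PhiP XP (i := i)).
  by rewrite word_deg_bw_word // size_map size_tuple.
by move: ck; rewrite -ck' ltnn.
Qed.

End OntoSums.

Section SecondMoments.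
Context {K : numClosedFieldType} {B : cstarAlgType K} {A A' : starAlgType K}.
Variables (iota : B -> A) (Phi : A -> B) (X : nat -> A).
Hypotheses (iotaP : star_embedding iota) (PhiP : cond_exp iota Phi).
Hypothesis XP : clt_sequence iota Phi X.
Variables (iota' : B -> A') (Phi' : A' -> B) (X' : nat -> A').
Hypotheses (iotaP' : star_embedding iota') (PhiP' : cond_exp iota' Phi').
Hypothesis XP' : clt_sequence iota' Phi' X'.
Hypothesis XX' : second_moment iota Phi (X 0) = second_moment iota' Phi' (X' 0).

Lemma onto_exp_second_moment c k : (bw_deg c <= k.*2)%N ->
  onto_exp iota Phi X c k = onto_exp iota' Phi' X' c k.
Proof.
move=> ck; apply: eq_bigr => t tT.
have tc : size (map val t) = bw_deg c by rewrite size_map size_tuple.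
case: (onto_count tT ck) => [[i i1]|[_ t2]].
  rewrite (word_exp_singleton iotaP PhiP XP (i := i)) ?word_deg_bw_word //.
  by rewrite (word_exp_singleton iotaP' PhiP' XP' (i := i)) ?word_deg_bw_word.
rewrite (word_exp_relabel iotaP PhiP XP iotaP' PhiP' XP' (g := id)) //.
  by rewrite (map_bw_word id) map_id.
move=> s i; rewrite word_deg_bw_word // => /leq_trans/(_ (t2 i)).
case: s => [_|b [_|//]]; last exact: (congr1 (fun h => h b) XX').
by rewrite [LHS](clt_centered XP) [RHS](clt_centered XP').
Qed.

End SecondMoments.

(** * Passage to the limit *)

Lemma complex_archi (R : realType) (x : R[i]) :
  0 <= x -> exists M : nat, x < M%:R.
Proof.
move=> x0; exists (Num.bound (complex.Re x)).
have -> n : n%:R = (n%:R)%:C%C :> R[i] by rewrite rmorph_nat.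
rewrite ltcE /= (ger0_Im x0) eqxx /=.
by apply: archi_boundP; move: x0; rewrite lecE => /andP[].
Qed.

Section ScalarLimits.
Variable C : numClosedFieldType.
Hypothesis archiC : forall x : C, 0 <= x -> exists M : nat, x < M%:R.

Lemma cvg_invsqrtC_nat : (fun N : nat => (sqrtC N%:R)^-1 : C) @ \oo --> (0 : C).
Proof.
apply/cvgr0Pnorm_lt => e e0.
have ei0 : 0 < e^-1 by rewrite invr_gt0.
have [M eM] := archiC (exprn_ge0 2 (ltW ei0)).
near=> N.
have MN : (M <= N)%N by near: N; exact: nbhs_infty_ge.
have eN : e^-1 ^+ 2 < N%:R by apply: lt_le_trans eM _; rewrite ler_nat.
have eN' : e^-1 < sqrtC N%:R.
  by rewrite -(@ltr_pXn2r _ 2) ?nnegrE ?sqrtC_ge0 ?ler0n ?(ltW ei0) // sqrtCK.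
have sN : 0 < sqrtC N%:R :> C by apply: lt_trans eN'.
by rewrite ger0_norm ?invr_ge0 ?(ltW sN) // invf_plt ?posrE.
Unshelve. all: by end_near. Qed.

Lemma cvgX_nat (u : nat -> C) (l : C) k :
  u @ \oo --> l -> (fun N => u N ^+ k) @ \oo --> l ^+ k.
Proof.
move=> ul; elim: k => [|k IHk]; first by apply: cvg_cst.
under eq_fun do rewrite exprS; rewrite exprS.
by apply: cvgM.
Qed.

(** Each factor N - i of the falling factorial, divided by N, tends to 1. *)
Lemma cvg_ffact k :
  (fun N : nat => (N ^_ k)%:R * (sqrtC N%:R)^-1 ^+ k.*2 : C) @ \oo --> (1 : C).
Proof.
elim: k => [|k IHk].
  rewrite [X in X @ _](_ : _ = fun=> 1); first exact: cvg_cst.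
  by apply/funext => N; rewrite ffactn0 double0 expr0 mulr1; exact: mulr1n.
have -> : (fun N : nat => (N ^_ k.+1)%:R * (sqrtC N%:R)^-1 ^+ k.+1.*2 : C) =
    (fun N : nat => ((N ^_ k)%:R * (sqrtC N%:R)^-1 ^+ k.*2) *
       ((N - k)%:R * (sqrtC N%:R)^-1 ^+ 2)).
  by apply/funext => N; rewrite ffactnSr natrM doubleS -(addn2 k.*2) exprD mulrACA.
rewrite -[X in cvg_to _ (nbhs X)]mulr1; apply: cvgM => //.
have : (fun N : nat => 1 - k%:R * (sqrtC N%:R)^-1 ^+ 2 : C) @ \oo --> (1 : C).
  have e : 1 - k%:R * 0 ^+ 2 = 1 :> C by rewrite expr0n mulr0 subr0.
  rewrite -[X in cvg_to _ (nbhs X)]e.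
  apply: cvgB; first exact: cvg_cst.
  apply: cvgM; first exact: cvg_cst.
  exact: cvgX_nat cvg_invsqrtC_nat.
apply: cvg_trans; apply: near_eq_cvg; near=> N.
have kN : (k < N)%N by near: N; exact: nbhs_infty_gt.
rewrite exprVn sqrtCK natrB ?(ltnW kN) // mulrBl divff //.
by rewrite pnatr_eq0 -lt0n (leq_ltn_trans _ kN).
Unshelve. all: by end_near. Qed.

(** The binomial coefficient grows like N^k / k!, which 2k of the n normalizing
   factors compensate; the others make the product tend to 0. *)
Lemma cvg_binomial_sqrtC n k : (k.*2 <= n)%N ->
  (fun N : nat => 'C(N, k)%:R * (sqrtC N%:R)^-1 ^+ n : C) @ \oo -->
  (0 ^+ (n - k.*2) / k`!%:R : C).
Proof.
move=> kn; have k0 : k`!%:R != 0 :> C by rewrite pnatr_eq0 -lt0n fact_gt0.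
have -> : (fun N : nat => 'C(N, k)%:R * (sqrtC N%:R)^-1 ^+ n : C) =
   (fun N : nat => (N ^_ k)%:R * (sqrtC N%:R)^-1 ^+ k.*2 *
      (sqrtC N%:R)^-1 ^+ (n - k.*2) * k`!%:R^-1).
  apply/funext => N; rewrite -bin_ffact natrM.
  rewrite -(mulrA _ (_ ^+ k.*2)) -exprD subnKC //.
  by rewrite [RHS]mulrAC mulfK.
apply: cvgM; last exact: cvg_cst.
rewrite -[X in cvg_to _ (nbhs X)]mul1r; apply: cvgM; first exact: cvg_ffact.
exact: cvgX_nat cvg_invsqrtC_nat.
Qed.

End ScalarLimits.

Section MonomialLimit.
Context {K : numClosedFieldType} {B : cstarAlgType K}.
Hypothesis archiK : forall x : K, 0 <= x -> exists M : nat, x < M%:R.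

Lemma cvgn_sum (V : normedModType K) (I : Type) (r : seq I)
    (u : I -> nat -> V) (l : I -> V) :
  (forall i, u i @ \oo --> l i) ->
  (fun N => \sum_(i <- r) u i N) @ \oo --> \sum_(i <- r) l i.
Proof.
move=> ul; elim: r => [|i r IHr].
  by under eq_fun do rewrite big_nil; rewrite big_nil; exact: cvg_cst.
by under eq_fun do rewrite big_cons; rewrite big_cons; exact: cvgD.
Qed.

Section OneSequence.
Context {A : starAlgType K}.
Variables (iota : B -> A) (Phi : A -> B) (X : nat -> A).
Hypotheses (iotaP : star_embedding iota) (PhiP : cond_exp iota Phi).
Hypothesis XP : clt_sequence iota Phi X.

(** For 2k less than the degree the coefficient is 0; for 2k greater than it the
   truncated difference is 0, but then the sum [onto_exp] vanishes. *)
Definition bw_limit (c : bword B) : B :=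
  \sum_(k < (bw_deg c).+1)
    (0 ^+ (bw_deg c - k.*2) / k`!%:R) *: onto_exp iota Phi X c k.

Lemma cvg_bw_limit c :
  (fun N => Phi (bw_eval iota (normalized_sum X N) c)) @ \oo --> bw_limit c.
Proof.
have -> : (fun N => Phi (bw_eval iota (normalized_sum X N) c)) =
    (fun N => \sum_(k < (bw_deg c).+1)
      ('C(N, k)%:R * (sqrtC N%:R)^-1 ^+ bw_deg c) *: onto_exp iota Phi X c k).
  apply/funext => N; rewrite /normalized_sum bw_eval_scale (cond_expZ PhiP).
  rewrite (cond_exp_sum_onto iotaP PhiP XP) scaler_sumr; apply: eq_bigr => k _.
  by rewrite mulrC -scalerA scaler_nat.
apply: (@cvgn_sum B _ (index_enum 'I_(bw_deg c).+1)
    (fun (k : 'I_(bw_deg c).+1) N =>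
  ('C(N, k)%:R * (sqrtC N%:R)^-1 ^+ bw_deg c) *: onto_exp iota Phi X c k)) => k.
have [ck|ck] := leqP k.*2 (bw_deg c).
  by apply: cvgZr_tmp; exact: cvg_binomial_sqrtC.
rewrite onto_exp_eq0 // scaler0; under eq_fun do rewrite scaler0.
exact: cvg_cst.
Qed.

End OneSequence.

(** The coefficient of the k-th term vanishes when the degree exceeds 2k. In the
   other terms a value is taken once, or every value is taken exactly twice. *)
Lemma bw_limit_second_moment (A A' : starAlgType K)
    (iota : B -> A) (Phi : A -> B) (X : nat -> A)
    (iota' : B -> A') (Phi' : A' -> B) (X' : nat -> A') c :
  star_embedding iota -> cond_exp iota Phi -> clt_sequence iota Phi X ->
  star_embedding iota' -> cond_exp iota' Phi' -> clt_sequence iota' Phi' X' ->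
  second_moment iota Phi (X 0) = second_moment iota' Phi' (X' 0) ->
  bw_limit iota Phi X c = bw_limit iota' Phi' X' c.
Proof.
move=> iotaP PhiP XP iotaP' PhiP' XP' XX'; apply: eq_bigr => k _.
have [ck|ck] := leqP (bw_deg c) k.*2.
  by rewrite (onto_exp_second_moment iotaP PhiP XP iotaP' PhiP' XP' XX').
by rewrite expr0n subn_eq0 leqNgt ck mul0r !scale0r.
Qed.

End MonomialLimit.

(** * Spanning the free algebra *)

Section FreeInduction.
Context {K : numClosedFieldType} {B : starAlgType K}.

Definition bw_free (c : bword B) : freeStar B :=
  bw_eval (@fconst K B) (fxi B) c.

Lemma feval_bw_free (A : starAlgType K) (iota : B -> A) (T : A) c :
  star_embedding iota -> feval iota T (bw_free c) = bw_eval iota T c.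
Proof.
move=> iotaP; have fM := feval_mul T iotaP; have fB := feval_const T iotaP.
have fl b f : feval iota T (lmulo (omap (@fconst K B) b) f) =
    lmulo (omap iota b) (feval iota T f) by case: b => //= b; rewrite fM fB.
have fr b f : feval iota T (rmulo f (omap (@fconst K B) b)) =
    rmulo (feval iota T f) (omap iota b) by case: b => //= b; rewrite fM fB.
rewrite /bw_free /bw_eval fr fl; congr (rmulo (lmulo _ _) _).
elim: (bw_inner c) => [|b s IHs] /=; first exact: feval_xi.
by rewrite fM fl IHs feval_xi.
Qed.

(** The constants and the monomials span the free algebra: the products by an
   element of the span, on one side and then on the other, preserve every
   subspace that contains them. *)
Lemma freeStar_bw_ind (Q : freeStar B -> Prop) :
  (forall a f g, Q f -> Q g -> Q (a *: f + g)) ->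
  (forall b, Q (fconst b)) -> (forall c, Q (bw_free c)) -> forall f, Q f.
Proof.
have cP := fconst_embedding B; have cM := emb_mul cP.
have c0 : fconst 0 = 0 :> freeStar B := emb0 cP.
move=> Qlin Qc Qm; elim/(@freeStar_ind K B) => p.
elim: p Q Qlin Qc Qm => [b||p IHp q IHq|a p IHp|p IHp q IHq] Q Qlin Qc Qm.
- exact: Qc.
- exact: (Qm (BWord None [::] None)).
- have -> : pcls (PD p q) = 1 *: pcls p + pcls q by rewrite scale1r -faddE.
  by apply: (Qlin); [exact: IHp | exact: IHq].
- have -> : pcls (PZ a p) = a *: pcls p + fconst 0 by rewrite c0 addr0 -fscaleE.
  by apply: (Qlin); [exact: IHp | exact: Qc].
have -> : pcls (PM p q) = pcls p ** pcls q by rewrite -fmulE.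
apply: (IHq (fun g => Q (pcls p ** g))) => [a f g|b|c].
- by rewrite smulDr smulZr; exact: Qlin.
- apply: (IHp (fun f => Q (f ** fconst b))) => [a f g|b'|c].
  + by rewrite smulDl smulZl; exact: Qlin.
  + by rewrite -cM; exact: Qc.
  + by rewrite -(bw_eval_mulr cP); exact: Qm.
- apply: (IHp (fun f => Q (f ** bw_free c))) => [a f g|b|d].
  + by rewrite smulDl smulZl; exact: Qlin.
  + by rewrite -(bw_eval_mull cP); exact: Qm.
  + by rewrite -(bw_eval_mul cP); exact: Qm.
Qed.

End FreeInduction.

(** * The central limit theorem *)

Section CStarContinuity.
Context {K : numClosedFieldType} {B : cstarAlgType K}.

Let smulB (x y z : B) : x ** (y - z) = x ** y - x ** z.
Proof. by rewrite -scaleN1r smulDr smulZr scaleN1r. Qed.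

Let smulBl (x y z : B) : (y - z) ** x = y ** x - z ** x.
Proof. by rewrite -scaleN1r smulDl smulZl scaleN1r. Qed.

Lemma cvg_smul (b c : B) (u : nat -> B) (l : B) :
  u @ \oo --> l -> (fun N => b ** u N ** c) @ \oo --> b ** l ** c.
Proof.
move=> /cvgrPdist_lt ul; apply/cvgrPdist_lt => e e0.
pose m := `|b| * `|c| + 1; have m0 : 0 < m by rewrite ltr_wpDl ?mulr_ge0.
near=> N; rewrite -smulBl -smulB.
apply: le_lt_trans (cstar_normM _ _) _.
apply: (@le_lt_trans _ _ (m * `|l - u N|)).
  apply: le_trans (ler_wpM2r (normr_ge0 _) (cstar_normM _ _)) _.
  by rewrite mulrAC ler_wpM2r // lerDl.
rewrite mulrC -ltr_pdivlMr //; near: N; apply: ul.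
by rewrite divr_gt0.
Unshelve. all: by end_near. Qed.

End CStarContinuity.

Section Limit.
Context {K : numClosedFieldType} {B : cstarAlgType K}.
Hypothesis archiK : forall x : K, 0 <= x -> exists M : nat, x < M%:R.

(** The limit is chosen before the second sequence, which may live in another
   algebra: this makes the dependence on the second moments alone part of the
   statement that is proved by induction on f. *)
Lemma clt_limit (A : starAlgType K) (iota : B -> A) (Phi : A -> B)
    (X : nat -> A) (f : freeStar B) :
  star_embedding iota -> cond_exp iota Phi -> clt_sequence iota Phi X ->
  exists l : B, forall (A' : starAlgType K) (iota' : B -> A') (Phi' : A' -> B)
    (X' : nat -> A'),
    star_embedding iota' -> cond_exp iota' Phi' -> clt_sequence iota' Phi' X' ->
    second_moment iota Phi (X 0) = second_moment iota' Phi' (X' 0) ->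
    (fun N => Phi' (feval iota' (normalized_sum X' N) f)) @ \oo --> l.
Proof.
move=> iotaP PhiP XP; elim/(@freeStar_bw_ind K B): f => [a f g [l lP] [m mP]|b|c].
- exists (a *: l + m) => A' iota' Phi' X' iotaP' PhiP' XP' XX'.
  under eq_fun do rewrite feval_linear // (cond_exp_linear PhiP').
  by apply: cvgD; [apply: cvgZl_tmp; exact: lP | exact: mP].
- exists b => A' iota' Phi' X' iotaP' PhiP' XP' XX'.
  under eq_fun do rewrite feval_const // (cond_exp_id PhiP').
  exact: cvg_cst.
exists (bw_limit iota Phi X c) => A' iota' Phi' X' iotaP' PhiP' XP' XX'.
under eq_fun do rewrite feval_bw_free //.
rewrite (bw_limit_second_moment c iotaP PhiP XP iotaP' PhiP' XP' XX').
exact: cvg_bw_limit.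
Qed.

End Limit.

Theorem theorem5p3 (R : realType) (B : cstarAlgType R[i])
    (A : starAlgType R[i]) (iota : B -> A) (Phi : A -> B) (X : nat -> A)
    (iotaP : star_embedding iota) (PhiP : cond_exp iota Phi)
    (XP : clt_sequence iota Phi X) :
  exists nu : freeStar B -> B,
    [/\ cond_exp (@fconst R[i] B) nu,
        forall f : freeStar B,
          (fun N : nat => Phi (feval iota (normalized_sum X N) f)) @ \oo --> nu f
      & forall (A' : starAlgType R[i]) (iota' : B -> A') (Phi' : A' -> B)
            (X' : nat -> A'),
          star_embedding iota' -> cond_exp iota' Phi' ->
          clt_sequence iota' Phi' X' ->
          (forall i j : nat, second_moment iota' Phi' (X' i) =
                             second_moment iota Phi (X j)) ->
          forall f : freeStar B,
            (fun N : nat => Phi' (feval iota' (normalized_sum X' N) f)) @ \oo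
              --> nu f].
Proof.
have /choice[nu nuP] f := clt_limit (@complex_archi R) f iotaP PhiP XP.
have nuA f := nuP f _ _ _ _ iotaP PhiP XP erefl.
have nuE f l :
    (fun N => Phi (feval iota (normalized_sum X N) f)) @ \oo --> l -> nu f = l.
  by move=> fl; apply: cvg_unique (nuA f) fl; exact: norm_hausdorff.
exists nu; split; [split| |].
- move=> a f g; apply: nuE.
  under eq_fun do rewrite feval_linear // (cond_exp_linear PhiP).
  by apply: cvgD; [apply: cvgZl_tmp; exact: nuA | exact: nuA].
- move=> b c f; apply: nuE.
  under eq_fun do
    rewrite !feval_mul // !feval_const // (cond_exp_bimod PhiP).
  exact: cvg_smul.
- move=> b; apply: nuE.
  under eq_fun do rewrite feval_const // (cond_exp_id PhiP).
  exact: cvg_cst.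
- exact: nuA.
by move=> A' iota' Phi' X' iotaP' PhiP' XP' XX' f; apply: nuP.
Qed.
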